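(* Let $a=\sqrt5-1$, $b=\sqrt5+3$, $c_1=\frac{3\sqrt5+8}{4}$, $c_2=-\frac{5\sqrt5+11}{32}$, $F=\frac{c_1a^2}{2}+\frac{c_2a^4}{4}$, and let $f:\mathbb{R}\to\mathbb{R}$ be defined by $$f(x)=\begin{cases}\frac14(x+a)^2-(\sqrt5+1)(x+a)+F,& x<-a,\\ \frac{c_1}{2}x^2+\frac{c_2}{4}x^4,& -a\le x\le a,\\ \frac14(x-a)^2+(\sqrt5+1)(x-a)+F,& x>a.\end{cases}$$ Then $f$ is twice continuously differentiable with $\frac12\le f''(x)\le c_1$ for all $x\in\mathbb{R}$ (so $f$ is strongly convex with Lipschitz-continuous derivative), and the Barzilai-Borwein method applied to $f$ with starting points $x_0=-b$, $x_1=-a$ generates $x_2=b$, $x_3=a$, $x_4=-b=x_0$, $x_5=-a=x_1$; hence it cycles between the four points $-b,-a,b,a$ and does not converge.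
   Context: For a univariate function $f$ with derivative $g=f'$, the two Barzilai-Borwein stepsizes (BB1: $\alpha_k=s_{k-1}^2/(s_{k-1}y_{k-1})$; BB2: $\alpha_k=s_{k-1}y_{k-1}/y_{k-1}^2$, where $s_{k-1}=x_k-x_{k-1}$ and $y_{k-1}=g(x_k)-g(x_{k-1})$) coincide, and the method is the iteration $x_{k+1}=x_k-\frac{x_k-x_{k-1}}{g(x_k)-g(x_{k-1})}\,g(x_k)$ for $k\ge 1$, started from given $x_0\ne x_1$. *)

(* Defs.v *)
From Stdlib Require Import Reals List.
From Coquelicot Require Import Coquelicot.
Open Scope R_scope.

Definition twice_continuously_differentiable (h : R -> R) : Prop :=
  (forall (n : nat) (x : R), (n <= 2)%nat -> ex_derive_n h n x) /\
  (forall x : R, continuous (Derive_n h 2) x).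

Definition strongly_convex (h : R -> R) : Prop :=
  exists mu : R, 0 < mu /\
    forall x y t : R, 0 <= t <= 1 ->
      h (t * x + (1 - t) * y)
        <= t * h x + (1 - t) * h y - mu / 2 * t * (1 - t) * (x - y) ^ 2.

Definition lipschitz_continuous (h : R -> R) : Prop :=
  exists L : R, 0 <= L /\
    forall x y : R, Rabs (h x - h y) <= L * Rabs (x - y).

(* In dimension one the stepsizes s^2 / (s y) and (s y) / y^2 are both s / y,
   where s and y are the differences of the last two iterates and of the
   derivative at them.  Division being total, the recursion is meaningful only
   as long as the denominators do not vanish. *)
Fixpoint BB_seq (h : R -> R) (x0 x1 : R) (k : nat) {struct k} : R :=
  match k with
  | O => x0
  | S O => x1
  | S (S i as j) =>
      BB_seq h x0 x1 j
      - (BB_seq h x0 x1 j - BB_seq h x0 x1 i)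
        / (Derive h (BB_seq h x0 x1 j) - Derive h (BB_seq h x0 x1 i))
        * Derive h (BB_seq h x0 x1 j)
  end.

Definition cyc_a : R := sqrt 5 - 1.
Definition cyc_b : R := sqrt 5 + 3.
Definition cyc_c1 : R := (3 * sqrt 5 + 8) / 4.
Definition cyc_c2 : R := - ((5 * sqrt 5 + 11) / 32).
Definition cyc_F : R := cyc_c1 * cyc_a ^ 2 / 2 + cyc_c2 * cyc_a ^ 4 / 4.

Definition cyc_f (x : R) : R :=
  if Rlt_dec x (- cyc_a) then
    1 / 4 * (x + cyc_a) ^ 2 - (sqrt 5 + 1) * (x + cyc_a) + cyc_F
  else if Rle_dec x cyc_a then
    cyc_c1 / 2 * x ^ 2 + cyc_c2 / 4 * x ^ 4
  else
    1 / 4 * (x - cyc_a) ^ 2 + (sqrt 5 + 1) * (x - cyc_a) + cyc_F.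

(* Main.v *)
Require Import Defs.
From Stdlib Require Import Reals List Lra Lia.
From Coquelicot Require Import Coquelicot.
Import ListNotations.
Open Scope R_scope.

(** The pieces of [cyc_f] are glued at [-a] and [a] with equal values, equal
    first derivatives (both equal to [-(sqrt 5 + 1)], resp. [sqrt 5 + 1]) and
    equal second derivatives (both equal to 1/2): this is what the constants
    [c1] and [c2] are chosen for.  A glueing lemma ([is_derive_glue]) then turns
    the piecewise formulas for f' and f'' into the derivatives of f on the whole
    line, the seams included.  The second derivative is 1/2 outside [[-a, a]]
    and [c1 + 3 c2 x^2] inside; since [c2 < 0] it decreases there from [c1] at 0
    to 1/2 at the seams, which gives the two bounds.  Strong convexity and the
    Lipschitz property are consequences of such bounds for any twice
    differentiable function, by the mean value theorem
    ([strongly_convex_of_derive2_bound], [lipschitz_of_derive_bound]).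

    The cycle only involves f' at four points, where f' is odd with
    [f'(a) = sqrt 5 + 1] and [f'(b) = sqrt 5 + 3].  The secant step from
    [(-b, -a)] has stepsize 4 / 2 and lands at [-a + 2 (sqrt 5 + 1) = b]; the
    one from [(-a, b)] subtracts
    [(sqrt 5 + 1) (sqrt 5 + 3) / (sqrt 5 + 2) = 4] and lands at [b - 4 = a].  By
    oddness the next two steps are the mirror images, so the pair of initial
    points recurs and with it the whole sequence ([BB_seq_periodic]); a periodic
    sequence that is not constant has no limit ([periodic_limit]). *)

(** * Glueing two functions at a point *)

Definition glue (c : R) (u v : R -> R) (x : R) : R :=
  if Rle_dec x c then u x else v x.

Lemma glue_left (c : R) (u v : R -> R) (x : R) :
  x <= c -> glue c u v x = u x.
Proof. intros Hx; unfold glue; destruct (Rle_dec x c); [reflexivity | lra]. Qed.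

Lemma glue_right (c : R) (u v : R -> R) (x : R) :
  u c = v c -> c <= x -> glue c u v x = v x.
Proof.
  intros Hc Hx; unfold glue; destruct (Rle_dec x c); [|reflexivity].
  replace x with c by lra; exact Hc.
Qed.

(** Away from the seam the glued function agrees locally with one of its
    pieces. At the seam, both difference quotients tend to the common
    derivative, and each increment is one of the two pieces' increments. *)
Lemma is_derive_glue (c : R) (u v du dv : R -> R) :
  (forall x, is_derive u x (du x)) -> (forall x, is_derive v x (dv x)) ->
  u c = v c -> du c = dv c ->
  forall x, is_derive (glue c u v) x (glue c du dv x).
Proof.
  intros Hu Hv Hc Hdc x.
  destruct (Rtotal_order x c) as [Hx | [-> | Hx]].
  - rewrite glue_left by lra.
    apply is_derive_ext_loc with u; [|apply Hu].
    apply filter_imp with (fun y => y < c); [|exact (open_lt c x Hx)].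
    intros y Hy; rewrite glue_left by lra; reflexivity.
  - rewrite glue_left by lra.
    apply is_derive_Reals; intros eps Heps.
    destruct (proj1 (is_derive_Reals _ _ _) (Hu c) eps Heps) as [d1 H1].
    destruct (proj1 (is_derive_Reals _ _ _) (Hv c) eps Heps) as [d2 H2].
    exists (mkposreal _ (Rmin_stable_in_posreal d1 d2)); simpl; intros h Hh Hhd.
    rewrite (glue_left c u v c) by lra.
    destruct (Rle_dec h 0).
    + rewrite glue_left by lra.
      apply H1; [exact Hh | exact (Rlt_le_trans _ _ _ Hhd (Rmin_l _ _))].
    + rewrite glue_right by (auto; lra); rewrite Hc, Hdc.
      apply H2; [exact Hh | exact (Rlt_le_trans _ _ _ Hhd (Rmin_r _ _))].
  - rewrite glue_right by (auto; lra).
    apply is_derive_ext_loc with v; [|apply Hv].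
    apply filter_imp with (fun y => c < y); [|exact (open_gt c x Hx)].
    intros y Hy; rewrite glue_right by (auto; lra); reflexivity.
Qed.

(** A glued function is [u (Rmin x c) + v (Rmax x c)] up to a constant, with no
    case distinction left. *)
Lemma continuous_glue (c : R) (u v : R -> R) :
  (forall x, continuous u x) -> (forall x, continuous v x) -> u c = v c ->
  forall x, continuous (glue c u v) x.
Proof.
  intros Hu Hv Hc x.
  assert (E : forall y : R,
    u ((y + c - Rabs (y - c)) / 2) + (v ((y + c + Rabs (y - c)) / 2) - v c)
    = glue c u v y).
  { intros y; destruct (Rle_dec y c).
    - rewrite glue_left, Rabs_left1 by lra.
      replace ((y + c - - (y - c)) / 2) with y by field.
      replace ((y + c + - (y - c)) / 2) with c by field. ring.
    - rewrite glue_right, Rabs_right by (auto; lra).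
      replace ((y + c - (y - c)) / 2) with c by field.
      replace ((y + c + (y - c)) / 2) with y by field. rewrite Hc; ring. }
  apply (continuous_ext _ _ _ E).
  assert (Habs : continuous (fun y => Rabs (y - c)) x).
  { apply (continuous_comp (fun y => y - c) Rabs); [|apply continuous_Rabs].
    apply (continuous_minus (V := R_NormedModule)); [apply continuous_id | apply continuous_const]. }
  assert (Hadd : continuous (fun y => y + c) x).
  { apply (continuous_plus (V := R_NormedModule)); [apply continuous_id | apply continuous_const]. }
  apply (continuous_plus (V := R_NormedModule)).
  - apply (continuous_comp (fun y => (y + c - Rabs (y - c)) / 2) u); [|apply Hu].
    apply (continuous_mult (fun y => y + c - Rabs (y - c)) (fun _ => / 2));
      [|apply continuous_const].
    apply (continuous_minus (V := R_NormedModule)); assumption.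
  - apply (continuous_minus (V := R_NormedModule)); [|apply continuous_const].
    apply (continuous_comp (fun y => (y + c + Rabs (y - c)) / 2) v); [|apply Hv].
    apply (continuous_mult (fun y => y + c + Rabs (y - c)) (fun _ => / 2));
      [|apply continuous_const].
    apply (continuous_plus (V := R_NormedModule)); assumption.
Qed.

(** * Consequences of bounds on the second derivative *)

Lemma mean_value (f df : R -> R) :
  (forall x, is_derive f x (df x)) ->
  forall x y, exists z,
    Rmin x y <= z <= Rmax x y /\ f y - f x = df z * (y - x).
Proof.
  intros Hf x y.
  apply MVT_gen.
  - intros; apply Hf.
  - intros z _; apply continuity_pt_filterlim, (ex_derive_continuous f).
    exists (df z); apply Hf.
Qed.

Lemma lipschitz_of_derive_bound (g dg : R -> R) (L : R) :
  (forall x, is_derive g x (dg x)) -> (forall x, Rabs (dg x) <= L) ->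
  lipschitz_continuous g.
Proof.
  intros Hg HL; exists L; split.
  - exact (Rle_trans _ _ _ (Rabs_pos (dg 0)) (HL 0)).
  - intros x y; destruct (mean_value g dg Hg y x) as (z & _ & ->).
    rewrite Rabs_mult; apply Rmult_le_compat_r; [apply Rabs_pos | apply HL].
Qed.

(** Subtracting the right-hand side leaves a function of [x] whose derivative
    has the sign of [x - z]. *)
Lemma quadratic_lower_bound (f g dg : R -> R) (m : R) :
  (forall x, is_derive f x (g x)) -> (forall x, is_derive g x (dg x)) ->
  (forall x, m <= dg x) ->
  forall z x, f z + g z * (x - z) + m / 2 * (x - z) ^ 2 <= f x.
Proof.
  intros Hf Hg Hm z x.
  set (q := fun w => f w - (g z * (w - z) + m / 2 * (w - z) ^ 2)).
  assert (Hq : forall w, is_derive q w (g w - (g z + m * (w - z)))).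
  { intros w; apply (is_derive_minus (V := R_NormedModule)); [apply Hf|].
    auto_derive; [trivial | ring_simplify; field]. }
  destruct (mean_value q _ Hq z x) as (w & Hw & Eq).
  destruct (mean_value g dg Hg z w) as (v & _ & Eg).
  specialize (Hm v).
  assert (Hpos : 0 <= (w - z) * (x - z)).
  { unfold Rmin, Rmax in Hw; destruct (Rle_dec z x); nra. }
  assert (H : 0 <= q x - q z).
  { rewrite Eq.
    replace (g w - (g z + m * (w - z))) with ((dg v - m) * (w - z))
      by (rewrite Rmult_minus_distr_r, <- Eg; ring).
    rewrite Rmult_assoc; apply Rmult_le_pos; lra. }
  unfold q in H; replace (z - z) with 0 in H by ring; simpl in H |- *; lra.
Qed.

(** The quadratic lower bounds at [z = t x + (1 - t) y], taken at [x] and at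
    [y], are averaged: the linear terms cancel and the quadratic ones add up to
    [t (1 - t) (x - y)^2]. *)
Lemma strongly_convex_of_derive2_bound (f g dg : R -> R) (m : R) :
  0 < m ->
  (forall x, is_derive f x (g x)) -> (forall x, is_derive g x (dg x)) ->
  (forall x, m <= dg x) ->
  strongly_convex f.
Proof.
  intros Hpos Hf Hg Hm; exists m; split; [exact Hpos|]; intros x y t Ht.
  set (z := t * x + (1 - t) * y).
  assert (Hx := quadratic_lower_bound f g dg m Hf Hg Hm z x).
  assert (Hy := quadratic_lower_bound f g dg m Hf Hg Hm z y).
  apply (Rmult_le_compat_l t) in Hx; [|lra].
  apply (Rmult_le_compat_l (1 - t)) in Hy; [|lra].
  replace (m / 2 * t * (1 - t) * (x - y) ^ 2) with
    (t * (g z * (x - z) + m / 2 * (x - z) ^ 2)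
     + (1 - t) * (g z * (y - z) + m / 2 * (y - z) ^ 2))
    by (unfold z; field).
  lra.
Qed.

(** * The derivatives of the piecewise function *)

Definition cyc_df : R -> R :=
  glue (- cyc_a) (fun x => / 2 * (x + cyc_a) - (sqrt 5 + 1))
    (glue cyc_a (fun x => cyc_c1 * x + cyc_c2 * x ^ 3)
       (fun x => / 2 * (x - cyc_a) + (sqrt 5 + 1))).

Definition cyc_ddf : R -> R :=
  glue (- cyc_a) (fun _ => / 2)
    (glue cyc_a (fun x => cyc_c1 + 3 * cyc_c2 * x ^ 2) (fun _ => / 2)).

Lemma sqrt5_sqr : sqrt 5 * sqrt 5 = 5.
Proof. apply sqrt_sqrt; lra. Qed.

Lemma sqrt5_bounds : 2 < sqrt 5 < 3.
Proof.
  assert (H := sqrt5_sqr); assert (H0 := sqrt_pos 5); split; nra.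
Qed.

Lemma cyc_a_pos : 0 < cyc_a.
Proof. unfold cyc_a; pose proof sqrt5_bounds; lra. Qed.

Lemma cyc_c2_neg : cyc_c2 < 0.
Proof. unfold cyc_c2; pose proof sqrt5_bounds; lra. Qed.

Lemma cyc_c2_sqr_a : cyc_c2 * cyc_a ^ 2 = - (sqrt 5 + 2) / 4.
Proof.
  pose proof sqrt5_sqr; unfold cyc_c2, cyc_a.
  replace ((sqrt 5 - 1) ^ 2) with (6 - 2 * sqrt 5) by nra.
  nra.
Qed.

Lemma cyc_df_seam : cyc_c1 * cyc_a + cyc_c2 * cyc_a ^ 3 = sqrt 5 + 1.
Proof.
  replace (cyc_c2 * cyc_a ^ 3) with (cyc_c2 * cyc_a ^ 2 * cyc_a) by ring.
  rewrite cyc_c2_sqr_a; unfold cyc_c1, cyc_a; pose proof sqrt5_sqr; nra.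
Qed.

Lemma cyc_ddf_seam : cyc_c1 + 3 * cyc_c2 * cyc_a ^ 2 = / 2.
Proof.
  replace (3 * cyc_c2 * cyc_a ^ 2) with (3 * (cyc_c2 * cyc_a ^ 2)) by ring.
  rewrite cyc_c2_sqr_a; unfold cyc_c1; field.
Qed.

(** The only point to check is the left seam, which [cyc_f] assigns to its middle
    piece and [glue] to its left one. *)
Lemma cyc_f_glue (x : R) :
  cyc_f x =
  glue (- cyc_a)
    (fun x => 1 / 4 * (x + cyc_a) ^ 2 - (sqrt 5 + 1) * (x + cyc_a) + cyc_F)
    (glue cyc_a (fun x => cyc_c1 / 2 * x ^ 2 + cyc_c2 / 4 * x ^ 4)
       (fun x => 1 / 4 * (x - cyc_a) ^ 2 + (sqrt 5 + 1) * (x - cyc_a) + cyc_F)) x.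
Proof.
  pose proof cyc_a_pos.
  unfold cyc_f; destruct (Rlt_dec x (- cyc_a)).
  - rewrite glue_left by lra; reflexivity.
  - rewrite glue_right; [reflexivity | | lra].
    rewrite glue_left by lra; unfold cyc_F; field.
Qed.

Lemma is_derive_cyc_f (x : R) : is_derive cyc_f x (cyc_df x).
Proof.
  pose proof cyc_a_pos; pose proof cyc_df_seam.
  eapply is_derive_ext; [intros t; symmetry; apply cyc_f_glue|].
  apply is_derive_glue.
  - intros y; auto_derive; [trivial | field].
  - apply is_derive_glue.
    + intros y; auto_derive; [trivial | field].
    + intros y; auto_derive; [trivial | field].
    + unfold cyc_F; field.
    + lra.
  - rewrite glue_left by lra; unfold cyc_F; field.
  - rewrite glue_left by lra; lra.
Qed.

Lemma is_derive_cyc_df (x : R) : is_derive cyc_df x (cyc_ddf x).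
Proof.
  pose proof cyc_a_pos; pose proof cyc_df_seam; pose proof cyc_ddf_seam.
  apply is_derive_glue.
  - intros y; auto_derive; [trivial | field].
  - apply is_derive_glue.
    + intros y; auto_derive; [trivial | ring].
    + intros y; auto_derive; [trivial | field].
    + lra.
    + lra.
  - rewrite glue_left by lra; lra.
  - rewrite glue_left by lra; lra.
Qed.

Lemma continuous_cyc_ddf (x : R) : continuous cyc_ddf x.
Proof.
  pose proof cyc_a_pos; pose proof cyc_ddf_seam.
  apply continuous_glue.
  - intros; apply continuous_const.
  - apply continuous_glue.
    + intros y; apply (ex_derive_continuous (fun x => cyc_c1 + 3 * cyc_c2 * x ^ 2)).
      auto_derive; trivial.
    + intros; apply continuous_const.
    + lra.
  - rewrite glue_left by lra; lra.
Qed.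

Lemma cyc_ddf_bounds (x : R) : 1 / 2 <= cyc_ddf x <= cyc_c1.
Proof.
  pose proof cyc_a_pos; pose proof cyc_c2_neg; pose proof cyc_ddf_seam.
  assert (Hc1 : / 2 <= cyc_c1) by (unfold cyc_c1; pose proof sqrt5_bounds; lra).
  unfold cyc_ddf, glue; destruct (Rle_dec x (- cyc_a)); [lra|].
  destruct (Rle_dec x cyc_a); [|lra].
  assert (x ^ 2 <= cyc_a ^ 2) by nra.
  assert (0 <= x ^ 2) by apply pow2_ge_0.
  split; nra.
Qed.

Lemma Derive_cyc_f (x : R) : Derive cyc_f x = cyc_df x.
Proof. apply is_derive_unique, is_derive_cyc_f. Qed.

Lemma is_derive_Derive_cyc_f (x : R) : is_derive (Derive cyc_f) x (cyc_ddf x).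
Proof.
  apply is_derive_ext with cyc_df; [|apply is_derive_cyc_df].
  intros t; symmetry; apply Derive_cyc_f.
Qed.

Lemma Derive2_cyc_f (x : R) : Derive_n cyc_f 2 x = cyc_ddf x.
Proof. apply is_derive_unique, is_derive_Derive_cyc_f. Qed.

(** * The cycle *)

Lemma Derive_cyc_f_neg_b : Derive cyc_f (- cyc_b) = - (sqrt 5 + 3).
Proof.
  rewrite Derive_cyc_f; unfold cyc_df.
  rewrite glue_left; unfold cyc_a, cyc_b; [field | lra].
Qed.

Lemma Derive_cyc_f_neg_a : Derive cyc_f (- cyc_a) = - (sqrt 5 + 1).
Proof.
  rewrite Derive_cyc_f; unfold cyc_df.
  rewrite glue_left by lra; field.
Qed.

Lemma Derive_cyc_f_a : Derive cyc_f cyc_a = sqrt 5 + 1.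
Proof.
  pose proof cyc_a_pos; pose proof cyc_df_seam.
  rewrite Derive_cyc_f; unfold cyc_df.
  rewrite glue_right, glue_left; try lra.
  rewrite glue_left by lra; lra.
Qed.

Lemma Derive_cyc_f_b : Derive cyc_f cyc_b = sqrt 5 + 3.
Proof.
  pose proof cyc_a_pos; pose proof cyc_df_seam.
  assert (cyc_a <= cyc_b) by (unfold cyc_a, cyc_b; lra).
  rewrite Derive_cyc_f; unfold cyc_df.
  rewrite glue_right, glue_right; try lra.
  - unfold cyc_a, cyc_b; field.
  - rewrite glue_left by lra; lra.
Qed.

(** Equivalent to [(s + 1) (s + 3) = 4 (s + 2)] for [s = sqrt 5], that is, to
    [s^2 = 5]. *)
Lemma long_step : (2 * sqrt 5 + 2) / (2 * sqrt 5 + 4) * (sqrt 5 + 3) = 4.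
Proof.
  pose proof sqrt5_sqr; pose proof sqrt5_bounds.
  apply Rmult_eq_reg_r with (2 * sqrt 5 + 4); [|lra].
  replace ((2 * sqrt 5 + 2) / (2 * sqrt 5 + 4) * (sqrt 5 + 3) * (2 * sqrt 5 + 4))
    with ((2 * sqrt 5 + 2) * (sqrt 5 + 3)) by (field; lra).
  nra.
Qed.

Lemma BB_seq_SS (h : R -> R) (x0 x1 : R) (k : nat) :
  BB_seq h x0 x1 (S (S k)) =
  BB_seq h x0 x1 (S k)
  - (BB_seq h x0 x1 (S k) - BB_seq h x0 x1 k)
    / (Derive h (BB_seq h x0 x1 (S k)) - Derive h (BB_seq h x0 x1 k))
    * Derive h (BB_seq h x0 x1 (S k)).
Proof. reflexivity. Qed.

(** The recursion has order two, so a pair of consecutive iterates determines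
    all later ones. *)
Lemma BB_seq_periodic (h : R -> R) (x0 x1 : R) (p : nat) :
  BB_seq h x0 x1 p = x0 -> BB_seq h x0 x1 (S p) = x1 ->
  forall k, BB_seq h x0 x1 (k + p) = BB_seq h x0 x1 k.
Proof.
  intros H0 H1 k.
  enough (BB_seq h x0 x1 (k + p) = BB_seq h x0 x1 k /\
          BB_seq h x0 x1 (S k + p) = BB_seq h x0 x1 (S k)) as [H _] by exact H.
  induction k as [|k [IH0 IH1]]; [split; assumption|].
  split; [exact IH1|].
  change (S (S k) + p)%nat with (S (S (k + p))).
  rewrite !BB_seq_SS; change (S (k + p)) with (S k + p)%nat.
  rewrite IH0, IH1; reflexivity.
Qed.

(** The values at [n], [n + p], [n + 2 p], ... form a constant subsequence. *)
Lemma periodic_limit (u : nat -> R) (p : nat) (l : R) :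
  (0 < p)%nat -> (forall k, u (k + p)%nat = u k) -> is_lim_seq u l ->
  forall n, u n = l.
Proof.
  intros Hp Hu Hl n.
  assert (Hn : forall k, u (n + k * p)%nat = u n).
  { induction k as [|k IH]; [f_equal; lia|].
    rewrite <- IH, <- (Hu (n + k * p)%nat); f_equal; lia. }
  assert (Hsub : is_lim_seq (fun k => u (n + k * p)%nat) l).
  { apply (is_lim_seq_subseq u l (fun k => (n + k * p)%nat)); [|exact Hl].
    apply eventually_subseq; intros k; nia. }
  apply is_lim_seq_unique in Hsub.
  rewrite (Lim_seq_ext _ (fun _ => u n) Hn), Lim_seq_const in Hsub.
  injection Hsub; auto.
Qed.

Theorem mainTheorem2 :
  twice_continuously_differentiable cyc_f /\
  (forall x : R, 1 / 2 <= Derive_n cyc_f 2 x <= cyc_c1) /\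
  strongly_convex cyc_f /\
  lipschitz_continuous (Derive cyc_f) /\
  let x := BB_seq cyc_f (- cyc_b) (- cyc_a) in
  (forall k : nat, Derive cyc_f (x (S k)) - Derive cyc_f (x k) <> 0) /\
  x 2%nat = cyc_b /\ x 3%nat = cyc_a /\
  x 4%nat = - cyc_b /\ x 4%nat = x 0%nat /\
  x 5%nat = - cyc_a /\ x 5%nat = x 1%nat /\
  NoDup [- cyc_b; - cyc_a; cyc_b; cyc_a] /\
  (forall k : nat, x (k + 4)%nat = x k) /\
  ~ ex_finite_lim_seq x.
Proof.
  pose proof sqrt5_bounds as Hb.
  split; [split|].
  { intros [|[|[|n]]] x Hn; [exact I | | | lia].
    - exists (cyc_df x); apply is_derive_cyc_f.
    - exists (cyc_ddf x); apply is_derive_Derive_cyc_f. }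
  { intros x; apply continuous_ext with cyc_ddf; [|apply continuous_cyc_ddf].
    intros y; symmetry; apply Derive2_cyc_f. }
  split; [intros x; rewrite Derive2_cyc_f; apply cyc_ddf_bounds|].
  split.
  { apply (strongly_convex_of_derive2_bound cyc_f cyc_df cyc_ddf (1 / 2)).
    - lra.
    - exact is_derive_cyc_f.
    - exact is_derive_cyc_df.
    - intros x; apply cyc_ddf_bounds. }
  split.
  { apply (lipschitz_of_derive_bound _ cyc_ddf cyc_c1).
    - exact is_derive_Derive_cyc_f.
    - intros x; pose proof (cyc_ddf_bounds x); rewrite Rabs_right; lra. }
  intros x.
  assert (x0 : x 0%nat = - cyc_b) by reflexivity.
  assert (x1 : x 1%nat = - cyc_a) by reflexivity.
  assert (x2 : x 2%nat = cyc_b).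
  { unfold x; rewrite BB_seq_SS; fold x.
    rewrite x1, x0, Derive_cyc_f_neg_a, Derive_cyc_f_neg_b.
    unfold cyc_a, cyc_b; field; lra. }
  assert (x3 : x 3%nat = cyc_a).
  { unfold x; rewrite BB_seq_SS; fold x.
    rewrite x2, x1, Derive_cyc_f_neg_a, Derive_cyc_f_b.
    transitivity (cyc_b - (2 * sqrt 5 + 2) / (2 * sqrt 5 + 4) * (sqrt 5 + 3)).
    - unfold cyc_a, cyc_b; field; lra.
    - rewrite long_step; unfold cyc_a, cyc_b; ring. }
  assert (x4 : x 4%nat = - cyc_b).
  { unfold x; rewrite BB_seq_SS; fold x.
    rewrite x3, x2, Derive_cyc_f_a, Derive_cyc_f_b.
    unfold cyc_a, cyc_b; field; lra. }
  assert (x5 : x 5%nat = - cyc_a).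
  { unfold x; rewrite BB_seq_SS; fold x.
    rewrite x4, x3, Derive_cyc_f_a, Derive_cyc_f_neg_b.
    transitivity (- cyc_b + (2 * sqrt 5 + 2) / (2 * sqrt 5 + 4) * (sqrt 5 + 3)).
    - unfold cyc_a, cyc_b; field; lra.
    - rewrite long_step; unfold cyc_a, cyc_b; ring. }
  assert (Hper : forall k, x (k + 4)%nat = x k)
    by exact (BB_seq_periodic _ _ _ 4 x4 x5).
  split.
  { (* Four consecutive indices cover a period, so they are carried together. *)
    set (P := fun k => Derive cyc_f (x (S k)) - Derive cyc_f (x k) <> 0).
    enough (H : forall k, (P k /\ P (1 + k)%nat) /\ P (2 + k)%nat /\ P (3 + k)%nat)
      by (intros k; apply H).
    intros k; induction k as [|k [[P0 P1] [P2 P3]]].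
    - unfold P; simpl Nat.add; rewrite x0, x1, x2, x3, x4.
      rewrite Derive_cyc_f_neg_a, Derive_cyc_f_neg_b, Derive_cyc_f_a, Derive_cyc_f_b.
      repeat split; lra.
    - assert (P4 : P (k + 4)%nat).
      { unfold P; change (S (k + 4)) with (S k + 4)%nat; rewrite !Hper; exact P0. }
      replace (k + 4)%nat with (3 + S k)%nat in P4 by lia.
      replace (2 + S k)%nat with (3 + k)%nat by lia.
      repeat split; assumption. }
  do 2 (split; [assumption|]).
  split; [exact x4|]; split; [exact x4|].
  split; [exact x5|]; split; [exact x5|].
  split.
  { unfold cyc_a, cyc_b.
    repeat constructor; simpl; intros H;
      repeat destruct H as [H | H]; try contradiction; lra. }
  split; [exact Hper|].
  intros [l Hl].
  assert (Hlim := periodic_limit x 4 l ltac:(lia) Hper Hl).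
  assert (E := eq_trans (Hlim 0%nat) (eq_sym (Hlim 2%nat))).
  rewrite x0, x2 in E; unfold cyc_b in E; lra.
Qed.
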